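(* Let $a>1$ and let $G$ be an infinite graph with pinched growth $a^r$, i.e. there are constants $0<c_1<c_2<\infty$ such that $c_1\,a^r<|B(v,r)|<c_2\,a^r$ for every vertex $v\in V(G)$ and every radius $r$. Then there is a constant $c>0$ such that for every finite set of vertices $A\subset V(G)$, $$|\partial A|\ \ge\ \frac{c\,|A|}{\log(2+|A|)}.$$
   Context: For a graph $G$ with vertex set $V(G)$, $d(v,u)$ denotes the graph distance, and $B(v,r)=\{u\in V(G): d(v,u)\le r\}$ is the ball of radius $r$ centered at the vertex $v$ (radii $r$ are nonnegative integers). $|S|$ denotes the cardinality of a set $S$. For $A\subset V(G)$, the (vertex) boundary $\partial A$ is the set of vertices outside of $A$ which have a neighbor in $A$. A graph $G$ has pinched growth $f(r)$ if there are two constants $0<c_1<c_2<\infty$ such that $c_1 f(r)<|B(v,r)|<c_2 f(r)$ for every $v\in V(G)$ and every radius $r$. *)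

(* Defs.v *)
From mathcomp Require Export all_boot all_order all_algebra finmap.
From mathcomp Require Export all_classical all_reals all_analysis.

Set Implicit Arguments.
Unset Strict Implicit.
Unset Printing Implicit Defensive.

Import Order.TTheory GRing.Theory Num.Theory.

Local Open Scope classical_set_scope.
Local Open Scope ring_scope.
Local Open Scope ereal_scope.

(* A simple undirected graph, not assumed connected or locally finite. *)
Record graph := Graph {
  vertex :> choiceType;
  adj : rel vertex;
  adj_sym : symmetric adj;
  adj_irr : irreflexive adj
}.

(* Length of a shortest walk from v to u; as ereal_inf set0 = +oo, vertices of
   distinct components are at distance +oo. *)
Definition gdist (R : realType) (G : graph) (v u : G) : \bar R :=
  ereal_inf [set (size p)%:R%:E | p in
    [set p : seq G | path (@adj G) v p /\ last v p = u]].

Definition gball (R : realType) (G : graph) (v : G) (r : nat) : set G :=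
  [set u | gdist R v u <= r%:R%:E].

Definition vboundary (G : graph) (A : set G) : set G :=
  [set u | ~ A u /\ exists2 v, A v & adj v u].

(* counting is +oo on infinite sets, so the upper bound forces finite balls. *)
Definition pinched_growth (R : realType) (G : graph) (f : nat -> R) : Prop :=
  exists c1 c2 : R, [/\ (0 < c1)%R, (c1 < c2)%R &
    forall (v : G) (r : nat),
      (c1 * f r)%:E < counting (gball R v r) /\
      counting (gball R v r) < (c2 * f r)%:E].

(* Main.v *)
Require Import Defs.
From mathcomp Require Import lra zify.

Set Implicit Arguments.
Unset Strict Implicit.
Unset Printing Implicit Defensive.

Import Order.TTheory GRing.Theory Num.Theory.

Local Open Scope classical_set_scope.
Local Open Scope ring_scope.

(** Fix a radius r with c1 a^r >= 2 |A|, so that for each v in A at least half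
of the ball B(v,r) lies outside A.  A walk of length at most r from v to a
point u of B(v,r) \ A must cross the boundary of A, say at w after k steps; then
v is in B(w,k) and u is in B(w,r-k).  Hence the pairs (v,u) with v in A and u
in B(v,r) \ A number at most the sum over w in the boundary and k <= r of
|B(w,k)| |B(w,r-k)|, which is [sum_escape_le].  The growth of balls being
exponential, every such product is at most c2^2 a^r, whatever k is, while the
number of pairs is at least |A| c1 a^r / 2.  The factor a^r cancels and leaves
|A| c1 <= 2 c2^2 (r+1) |boundary of A|, which is [isoperimetry_at_radius].
By [log_radius], r can be chosen at most a constant times log (2 + |A|); that
logarithm is the one in the denominator of the theorem. *)

Lemma leq_card_bigfcup (I T : choiceType) (s : seq I) (F : I -> {fset T}) :
  (#|` \bigcup_(i <- s) F i|%fset <= \sum_(i <- s) #|` F i|)%N.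
Proof.
elim/big_ind2: _ => [|X m Y n leXm leYn|//]; first by rewrite cardfs0.
by rewrite cardfsU (leq_trans (leq_subr _ _))// leq_add.
Qed.

Lemma count_mem_fset_le (T : choiceType) (X Y : {fset T}) :
  (\sum_(x <- X) (x \in Y) <= #|` Y|)%N.
Proof.
have -> : (\sum_(x <- X) (x \in Y) = count (mem Y) X)%N.
  by rewrite -sum1_count [RHS]big_mkcond; apply: eq_bigr => x _ /=;
     case: (x \in Y).
rewrite -size_filter.
apply: uniq_leq_size => [|x]; first by rewrite filter_uniq.
by rewrite mem_filter => /andP[].
Qed.

(** The infimum defining the distance ranges over integers, so a distance at
most r is witnessed by an actual walk of length at most r. *)
Lemma gballP (R : realType) (G : graph) (v u : G) (r : nat) :
  gball R v r u <->
  exists p : seq G, [/\ path (@adj G) v p, last v p = u & (size p <= r)%N].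
Proof.
split=> [vru|[p [vp pu pr]]].
  have /ereal_inf_lt[_ [p [vp pu] <-]] : (gdist R v u < r.+1%:R%:E)%E.
    by apply: le_lt_trans vru _; rewrite lte_fin ltr_nat.
  by rewrite lte_fin ltr_nat ltnS => pr; exists p.
apply: (@le_trans _ _ (size p)%:R%:E); last by rewrite lee_fin ler_nat.
by apply: ereal_inf_lbound; exists p.
Qed.

Lemma gball_sym (R : realType) (G : graph) (v u : G) (r : nat) :
  gball R v r u -> gball R u r v.
Proof.
move=> /gballP[p [vp pu pr]]; apply/gballP; exists (rev (belast v p)); split.
- by rewrite -pu rev_path (eq_path (e' := @adj G))// => x y; rewrite adj_sym.
- by case: p {vp pr} pu => [|x p] //= _; rewrite rev_cons last_rcons.
- by rewrite size_rev size_belast.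
Qed.

(** The vertex w is the first one outside A on a walk from v to u, and k is the
time at which the walk reaches it; the two halves of the walk give the two
ball memberships. *)
Lemma gball_exit (R : realType) (G : graph) (A : set G) (v u : G) (r : nat) :
  A v -> ~ A u -> gball R v r u ->
  exists w (k : nat), [/\ vboundary A w, (k <= r)%N, gball R w k v &
                          gball R w (r - k) u].
Proof.
move=> Av Au /gballP[p [vp pu pr]].
suff [w [p1 [p2 [Dw Ep vp1 p1w wp2]]]] : exists w p1 p2,
    [/\ vboundary A w, p = p1 ++ p2, path (@adj G) v p1, last v p1 = w &
        path (@adj G) w p2 /\ last w p2 = u].
  exists w, (size p1); move: pr; rewrite Ep size_cat => pr; split => //.
  - by rewrite (leq_trans (leq_addr _ _) pr).
  - by apply/gball_sym/gballP; exists p1.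
  - apply/gballP; exists p2; case: wp2; split => //.
    by rewrite leq_subRL ?(leq_trans (leq_addr _ _) pr).
elim: p v Av vp pu {pr} => [|x p IH] v Av /=.
  by move=> _ vu; rewrite vu in Av.
move=> /andP[vx xp] pu; have [Ax|Ax] := pselect (A x).
  have [w [p1 [p2 [Dw -> xp1 p1w wp2]]]] := IH x Ax xp pu.
  by exists w, (x :: p1), p2; split => //=; rewrite vx.
exists x, [:: x], p; split => //; last by rewrite /= vx.
by split => //; exists v.
Qed.

(** Both sides bound the number of pairs (v,u) with v in A and u in
B(v,r) \ A: the left side is that number, and the right side counts each pair
at least once, through the boundary vertex and the exit time of
[gball_exit]. *)
Lemma sum_escape_le (R : realType) (G : graph) (A : set G) (r : nat) :
  (forall (v : G) k, finite_set (gball R v k)) ->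
  finite_set A -> finite_set (vboundary A) ->
  (\sum_(v <- fset_set A) #|` fset_set (gball R v r) `\` fset_set A|%fset <=
   \sum_(w <- fset_set (vboundary A)) \sum_(k < r.+1)
     #|` fset_set (gball R w k)| * #|` fset_set (gball R w (r - k))|)%N.
Proof.
move=> finB finA finD.
(* The points that a walk from v, at w after k steps, can still reach. *)
pose through v w (k : 'I_r.+1) : {fset G} :=
  if v \in fset_set (gball R w k) then fset_set (gball R w (r - k)) else fset0.
have escape v : v \in fset_set A ->
    (#|` fset_set (gball R v r) `\` fset_set A|%fset <=
     \sum_(w <- fset_set (vboundary A)) \sum_(k < r.+1)
       (v \in fset_set (gball R w k)) * #|` fset_set (gball R w (r - k))|)%N.
  rewrite in_fset_set// inE => Av.
  apply: (@leq_trans #|` \bigcup_(w <- fset_set (vboundary A))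
                        \bigcup_(k <- index_enum 'I_r.+1) through v w k|%fset).
    apply/fsubset_leq_card/fsubsetP => u.
    rewrite in_fsetD !in_fset_set// => /andP[/negP]; rewrite !inE => Au vru.
    have [w [k [Dw kr wkv wku]]] := gball_exit Av Au vru.
    apply/bigfcupP; exists w; first by rewrite in_fset_set// mem_set.
    apply/bigfcupP; exists (inord k) => /=; first by rewrite mem_index_enum.
    rewrite /through inordK// in_fset_set// mem_set//.
    by rewrite in_fset_set// mem_set.
  apply: leq_trans (leq_card_bigfcup _ _) _; apply: leq_sum => w _.
  apply: leq_trans (leq_card_bigfcup _ _) _; apply: leq_sum => k _.
  by rewrite /through; case: ifP; rewrite ?mul1n// cardfs0.
apply: (@leq_trans (\sum_(v <- fset_set A)
    \sum_(w <- fset_set (vboundary A)) \sum_(k < r.+1)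
       (v \in fset_set (gball R w k)) * #|` fset_set (gball R w (r - k))|)%N).
  by rewrite big_seq [leqRHS]big_seq; apply: leq_sum.
rewrite exchange_big; apply: leq_sum => w _.
rewrite exchange_big; apply: leq_sum => k _ /=.
by rewrite -big_distrl leq_mul2r count_mem_fset_le orbT.
Qed.

(** The bounds c2 a^k and c2 a^(r-k) on the two balls multiply to c2^2 a^r for
every k, so the sum over exit times costs only the factor r+1. *)
Lemma isoperimetry_at_radius (R : realType) (G : graph) (a c1 c2 : R)
    (A : set G) (r : nat) :
    1 < a -> 0 < c1 ->
    (forall (v : G) k, finite_set (gball R v k)) ->
    (forall (v : G) k,
       c1 * a ^+ k <= #|` fset_set (gball R v k)|%:R <= c2 * a ^+ k) ->
    finite_set A -> finite_set (vboundary A) ->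
    2 * #|` fset_set A|%:R <= c1 * a ^+ r ->
  #|` fset_set A|%:R * c1 <=
    2 * c2 ^+ 2 * r.+1%:R * #|` fset_set (vboundary A)|%:R.
Proof.
move=> a1 c10 finB growth finA finD.
set n := #|` fset_set A|; set m := #|` fset_set (vboundary A)| => nr.
have ar0 : 0 < a ^+ r by rewrite exprn_gt0// (lt_trans ltr01).
(* At most n <= c1 a^r / 2 points of each ball lie in A. *)
have lower : n%:R * (c1 * a ^+ r) <= 2 * (\sum_(v <- fset_set A)
    #|` fset_set (gball R v r) `\` fset_set A|%fset)%:R :> R.
  rewrite natr_sum mulr_sumr /n mulr_natl.
  rewrite -[in leLHS](count_predT (fset_set A)) -iter_addr_0 -big_const_seq.
  apply: ler_sum => v _.
  have [lo _] := andP (growth v r).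
  have : (#|` fset_set (gball R v r)|%fset <=
      n + #|` fset_set (gball R v r) `\` fset_set A|%fset)%N.
    by rewrite -(cardfsID (fset_set A)) leq_add2r fsubset_leq_card// fsubsetIr.
  by rewrite -(ler_nat R) natrD; lra.
have upper : (\sum_(v <- fset_set A)
      #|` fset_set (gball R v r) `\` fset_set A|%fset)%:R <=
    m%:R * (r.+1%:R * (c2 ^+ 2 * a ^+ r)) :> R.
  apply: le_trans (_ : (\sum_(w <- fset_set (vboundary A)) \sum_(k < r.+1)
     #|` fset_set (gball R w k)| *
     #|` fset_set (gball R w (r - k))|)%N%:R <= _).
    by rewrite ler_nat sum_escape_le.
  rewrite natr_sum /m mulr_natl -(count_predT (fset_set (vboundary A))).
  rewrite -iter_addr_0 -big_const_seq; apply: ler_sum => w _.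
  rewrite natr_sum mulr_natl -[in leRHS](card_ord r.+1) -sumr_const.
  apply: ler_sum => k _; rewrite natrM.
  have kr : (k <= r)%N by rewrite -ltnS.
  rewrite -[in leRHS](subnKC kr) exprD expr2 mulrACA.
  apply: ler_pM => //; first by case/andP: (growth w k).
  by case/andP: (growth w (r - k)%N).
have : (n%:R * c1) * a ^+ r <= (2 * c2 ^+ 2 * r.+1%:R * m%:R) * a ^+ r by nra.
by rewrite ler_pM2r.
Qed.

Lemma expr_unbounded (R : realType) (a x : R) : 1 < a -> exists q, x <= a ^+ q.
Proof.
move=> a1; have la : 0 < ln a by rewrite ln_gt0.
pose q := (Num.truncn (x / ln a)).+1; exists q.
have -> : a ^+ q = expR (q%:R * ln a).
  by rewrite mulr_natl -lnXn ?lnK// ?posrE ?exprn_gt0// (lt_trans ltr01).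
apply: le_trans (expR_ge1Dx _).
have : x <= q%:R * ln a; last by lra.
rewrite -ler_pdivrMr//; exact/ltW/truncnS_gt.
Qed.

(** The radius is taken of the form q2 + q1 t, where a^q1 >= 2 and 2^t > n: the
summand q2 absorbs the constant 2 / c1, and t is of the order of ln (2 + n).
As ln (2 + n) >= ln 2 even for n = 0, additive constants in r are absorbed into
C as well. *)
Lemma log_radius (R : realType) (a c1 : R) : 1 < a -> 0 < c1 ->
  exists2 C : R, 0 < C & forall n : nat, exists2 r : nat,
    2 * n%:R <= c1 * a ^+ r & r.+1%:R <= C * ln (2 + n%:R).
Proof.
move=> a1 c10.
have a0 : 0 < a by rewrite (lt_trans ltr01).
have [q1 aq1] := expr_unbounded 2 a1.
have [q2 aq2] := expr_unbounded (2 / c1) a1.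
have ln2 : 0 < ln 2 :> R by rewrite ln_gt0// ltr1n.
pose q := (q1 + q2).+1.
exists (2 * q%:R / ln 2); first by rewrite divr_gt0// mulr_gt0// ltr0n.
move=> n; pose t := (trunc_log 2 (2 + n)).+1.
exists (q2 + q1 * t)%N.
  rewrite exprD exprM mulrA; apply: ler_pM => //.
    by rewrite mulrC -ler_pdivrMr.
  apply: (@le_trans _ _ (2 ^+ t)); last first.
    by rewrite lerXn2r// nnegrE ?exprn_ge0// ltW.
  rewrite -natrX ler_nat.
  by rewrite (leq_trans (leq_addl 2 n))// ltnW// /t trunc_log_ltn.
have pos2n : 0 < 2 + n%:R :> R by rewrite -natrD ltr0n.
have tl : t%:R * ln 2 <= 2 * ln (2 + n%:R) :> R.
  have h1 : (trunc_log 2 (2 + n))%:R * ln 2 <= ln (2 + n%:R) :> R.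
    rewrite mulr_natl -lnXn// ler_ln ?posrE ?exprn_gt0//.
    by rewrite -natrX -natrD ler_nat trunc_logP.
  have h2 : ln 2 <= ln (2 + n%:R) :> R.
    by rewrite ler_ln ?posrE// lerDl.
  by rewrite /t -natr1; lra.
have rq : (q2 + q1 * t).+1%:R <= q%:R * t%:R :> R.
  by rewrite -natrM ler_nat /q; nia.
apply: le_trans rq _.
rewrite mulrAC ler_pdivlMr// -mulrA (mulrAC 2) [2 * _ * _]mulrC.
by rewrite ler_wpM2l.
Qed.

Theorem theorem1 (R : realType) (a : R) (ha : 1 < a) (G : graph)
    (hinf : infinite_set [set: G])
    (hG : pinched_growth G (fun r : nat => a ^+ r)) :
  exists2 c : R, 0 < c &
    forall A : set G, finite_set A ->
      ((c * #|` fset_set A|%:R / ln (2 + #|` fset_set A|%:R))%:E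
         <= counting (vboundary A))%E.
Proof.
have [c1 [c2 [c10 c12 growth]]] := hG.
have finB (v : G) (r : nat) : finite_set (gball R v r).
  by have [_] := growth v r; rewrite /counting; case: asboolP.
have cardB (v : G) (r : nat) :
  c1 * a ^+ r <= #|` fset_set (gball R v r)|%:R <= c2 * a ^+ r.
  have [] := growth v r; rewrite /counting asboolT// !lte_fin => lo hi.
  by rewrite !ltW.
have [C C0 radius] := log_radius ha c10.
have c20 : 0 < c2 by exact: lt_trans c12.
exists (c1 / (2 * c2 ^+ 2 * C)).
  by rewrite divr_gt0// !mulr_gt0// exprn_gt0.
move=> A finA; rewrite /counting; case: asboolP => [finD|_]; last exact: leey.
rewrite lee_fin.
have [r nr rC] := radius #|` fset_set A|.
have L0 : 0 < ln (2 + #|` fset_set A|%:R) :> R.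
  by rewrite ln_gt0// -natrD ltr1n.
have iso := isoperimetry_at_radius ha c10 finB cardB finA finD nr.
rewrite ler_pdivrMr// mulrAC ler_pdivrMr ?mulr_gt0 ?exprn_gt0//.
rewrite mulrC; apply: le_trans iso _.
rewrite [leLHS]mulrC -[leRHS]mulrA ler_wpM2l// [leRHS]mulrC -[leRHS]mulrA.
by rewrite ler_wpM2l// mulr_ge0// exprn_ge0// ltW.
Qed.
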